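(* Let $(A,\cdot,\alpha)$ be a Hom-pre-Malcev algebra, $(V,\ell,r,\beta)$ a bimodule of $A$, and $T:V\to A$ an $\mathcal O$-operator of $(A,\cdot,\alpha)$ associated to $(V,\ell,r,\beta)$. Define for all $a,b\in V$ $$a\blacktriangleright b=r(T(b))a,\qquad a\blacktriangleleft b=\ell(T(a))b.$$ Then $(V,\blacktriangleright,\blacktriangleleft,\beta)$ is a Hom-M-dendriform algebra. Therefore $V$ carries the Hom-pre-Malcev algebra structure with product $a\blacktriangleleft b+a\blacktriangleright b$ (the associated horizontal Hom-pre-Malcev algebra of $(V,\blacktriangleright,\blacktriangleleft,\beta)$), and $T$ is a morphism of Hom-pre-Malcev algebras from it to $(A,\cdot,\alpha)$. Moreover, $T(V)=\{T(v)\mid v\in V\}\subset A$ is a Hom-pre-Malcev subalgebra of $(A,\cdot,\alpha)$, and there is an induced (well-defined) Hom-M-dendriform algebra structure $(T(V),\triangleright,\triangleleft,\alpha)$ given, for all $a,b\in V$, by $$T(a)\triangleright T(b)=T(a\blacktriangleright b),\qquad T(a)\triangleleft T(b)=T(a\blacktriangleleft b).$$ Its associated horizontal Hom-pre-Malcev algebra structure on $T(V)$ is just the subalgebra structure of $(A,\cdot,\alpha)$, and $T$ is a homomorphism of Hom-M-dendriform algebras.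
   Context: All vector spaces are over a field $\mathbb K$ of characteristic $0$. A Hom-algebra is a vector space with a bilinear product (or several) and a linear twisting map; all are assumed multiplicative, i.e. the twisting map is an endomorphism of each product. Morphisms are linear maps preserving all products and commuting with twisting maps; subalgebras are subspaces closed under products and the twisting map. A Hom-pre-Malcev algebra is a Hom-algebra $(A,\cdot,\alpha)$ such that, with $[x,y]=x\cdot y-y\cdot x$, for all $x,y,z,t\in A$: $$[\alpha(y),\alpha(z)]\cdot\alpha(x\cdot t)+[[x,y],\alpha(z)]\cdot\alpha^2(t)+\alpha^2(y)\cdot([x,z]\cdot\alpha(t))-\alpha^2(x)\cdot(\alpha(y)\cdot(z\cdot t))+\alpha^2(z)\cdot(\alpha(x)\cdot(y\cdot t))=0.$$ A bimodule of a Hom-pre-Malcev algebra $(A,\cdot,\alpha)$ is $(V,\ell,r,\beta)$ with $V$ a vector space, $\ell,r:A\to\mathrm{End}(V)$ linear, $\beta\in\mathrm{End}(V)$, such that, with $\rho(x)=\ell(x)-r(x)$ and $[x,y]=x\cdot y-y\cdot x$, for all $x,y,z\in A$: (B1) $\beta\ell(x)=\ell(\alpha(x))\beta$, $\beta r(x)=r(\alpha(x))\beta$; (B2) $r(\alpha^2(x))\rho(\alpha(y))\rho(z)-r(\alpha(z)\cdot(y\cdot x))\beta^2+\ell(\alpha^2(y))r(z\cdot x)\beta+\ell(\alpha([z,y]))r(\alpha(x))\beta-\ell(\alpha^2(z))r(\alpha(x))\rho(y)=0$; (B3) $\ell(\alpha^2(y))\ell(\alpha(z))r(x)-r(\alpha^2(x))\rho(\alpha(y))\rho(z)-\ell(\alpha^2(z))r(y\cdot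 x)\beta-r(\alpha(z\cdot x))\rho(\alpha(y))\beta+r([z,y]\cdot\alpha(x))\beta^2=0$; (B4) $r(\alpha(y)\cdot(z\cdot x))\beta^2+r(\alpha^2(x))\rho([y,z])\beta-\ell(\alpha^2(y))\ell(\alpha(z))r(x)+r(\alpha(y\cdot x))\rho(\alpha(z))\beta+\ell(\alpha^2(z))r(\alpha(x))\rho(y)=0$; (B5) $\ell([[x,y],\alpha(z)])\beta^2-\ell(\alpha^2(x))\ell(\alpha(y))\ell(z)+\ell(\alpha^2(z))\ell(\alpha(x))\ell(y)+\ell(\alpha([y,z]))\ell(\alpha(x))\beta+\ell(\alpha^2(y))\ell([x,z])\beta=0$. An $\mathcal O$-operator of $(A,\cdot,\alpha)$ associated to $(V,\ell,r,\beta)$ is a linear map $T:V\to A$ with $T\circ\beta=\alpha\circ T$ and $T(a)\cdot T(b)=T(\ell(T(a))b+r(T(b))a)$ for all $a,b\in V$. A Hom-M-dendriform algebra $(A,\blacktriangleright,\blacktriangleleft,\alpha)$ is a vector space $A$ with bilinear products $\blacktriangleright,\blacktriangleleft$ and a linear map $\alpha$ (multiplicative for both products) such that, with $x\cdot y=x\blacktriangleleft y+x\blacktriangleright y$, $x\diamond y=x\blacktriangleleft y-y\blacktriangleright x$, $[x,y]=x\cdot y-y\cdot x=x\diamond y-y\diamond x$, for all $x,y,z,t\in A$: (D1) $(\alpha(z)\diamond(y\diamond x))\blacktriangleright\alpha^2(t)-\alpha^2(x)\blacktriangleright(\alpha(y)\cdot(z\cdot t))+\alpha^2(z)\blacktriangleleft(\alpha(x)\blacktriangleright(y\cdot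 t))+\alpha([y,z])\blacktriangleleft\alpha(x\blacktriangleright t)-\alpha^2(y)\blacktriangleleft((z\diamond x)\blacktriangleright\alpha(t))=0$; (D2) $\alpha^2(z)\blacktriangleleft(\alpha(x)\blacktriangleleft(y\blacktriangleright t))-(\alpha(z)\diamond(x\diamond y))\blacktriangleright\alpha^2(t)-\alpha^2(x)\blacktriangleleft(\alpha(y)\blacktriangleright(z\cdot t))-\alpha(z\diamond y)\blacktriangleright\alpha(x\cdot t)+\alpha^2(y)\blacktriangleright([x,z]\cdot\alpha(t))=0$; (D3) $\alpha^2(z)\blacktriangleright(\alpha(x)\cdot(y\cdot t))+([x,y]\diamond\alpha(z))\blacktriangleright\alpha^2(t)-\alpha^2(x)\blacktriangleleft(\alpha(y)\blacktriangleleft(z\blacktriangleright t))+\alpha(y\diamond z)\blacktriangleright\alpha(x\cdot t)+\alpha^2(y)\blacktriangleleft((x\diamond z)\blacktriangleright\alpha(t))=0$; (D4) $[[x,y],\alpha(z)]\blacktriangleleft\alpha^2(t)-\alpha^2(x)\blacktriangleleft(\alpha(y)\blacktriangleleft(z\blacktriangleleft t))+\alpha^2(z)\blacktriangleleft(\alpha(x)\blacktriangleleft(y\blacktriangleleft t))+\alpha([y,z])\blacktriangleleft\alpha(x\blacktriangleleft t)+\alpha^2(y)\blacktriangleleft([x,z]\blacktriangleleft\alpha(t))=0$. For such an algebra $(A,\cdot,\alpha)$ is a Hom-pre-Malcev algebra, called the associated horizontal one. *)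

(* Defs.v *)
From HB Require Import structures.
From mathcomp Require Import all_boot all_order all_algebra.
From mathcomp Require Import boolp classical_sets.

Set Implicit Arguments.
Unset Strict Implicit.
Unset Printing Implicit Defensive.

Import GRing.Theory.
Local Open Scope ring_scope.

(* Products and twisting maps are plain functions; their (bi)linearity is part
   of the structure predicates below. *)
Local Notation bilinear f := (bilinear_for *:%R *:%R f).

Section Algebras.
Context {K : fieldType}.
Implicit Types A B V : lmodType K.

Definition bracket {A} (mul : A -> A -> A) (x y : A) : A := mul x y - mul y x.

Record hom_pre_Malcev {A} (mul : A -> A -> A) (alpha : A -> A) : Prop :=
  HomPreMalcev {
    hpm_bilinear : bilinear mul;
    hpm_linear : linear alpha;
    hpm_multiplicative : {morph alpha : x y / mul x y};
    hpm_identity : forall x y z t : A,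
      let brk := bracket mul in
      let alpha2 u := alpha (alpha u) in
      mul (brk (alpha y) (alpha z)) (alpha (mul x t))
      + mul (brk (brk x y) (alpha z)) (alpha2 t)
      + mul (alpha2 y) (mul (brk x z) (alpha t))
      - mul (alpha2 x) (mul (alpha y) (mul z t))
      + mul (alpha2 z) (mul (alpha x) (mul y t)) = 0 }.

Record hom_pre_Malcev_morphism {A B}
    (mulA : A -> A -> A) (alphaA : A -> A)
    (mulB : B -> B -> B) (alphaB : B -> B) (f : A -> B) : Prop :=
  HomPreMalcevMorphism {
    hpmm_linear : linear f;
    hpmm_mul : {morph f : x y / mulA x y >-> mulB x y};
    hpmm_twist : {morph f : x / alphaA x >-> alphaB x} }.

Record hom_pre_Malcev_subalgebra {A} (mul : A -> A -> A) (alpha : A -> A)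
    (S : {pred A}) : Prop :=
  HomPreMalcevSubalgebra {
    hpms_subspace : submod_closed S;
    hpms_mul : {in S &, forall x y, mul x y \in S};
    hpms_twist : {in S, forall x, alpha x \in S} }.

(* A linear map A -> End(V) is a bilinear map A -> V -> V; identities in End(V)
   are stated pointwise. *)
Record bimodule {A V} (mul : A -> A -> A) (alpha : A -> A)
    (l r : A -> V -> V) (beta : V -> V) : Prop :=
  Bimodule {
    bim_l_linear : bilinear l;
    bim_r_linear : bilinear r;
    bim_linear : linear beta;
    bim_B1l : forall x v, beta (l x v) = l (alpha x) (beta v);
    bim_B1r : forall x v, beta (r x v) = r (alpha x) (beta v);
    bim_B2 : forall x y z v,
      let brk := bracket mul in
      let rho u w := l u w - r u w in
      let alpha2 u := alpha (alpha u) in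
      let beta2 w := beta (beta w) in
      r (alpha2 x) (rho (alpha y) (rho z v))
      - r (mul (alpha z) (mul y x)) (beta2 v)
      + l (alpha2 y) (r (mul z x) (beta v))
      + l (alpha (brk z y)) (r (alpha x) (beta v))
      - l (alpha2 z) (r (alpha x) (rho y v)) = 0;
    bim_B3 : forall x y z v,
      let brk := bracket mul in
      let rho u w := l u w - r u w in
      let alpha2 u := alpha (alpha u) in
      let beta2 w := beta (beta w) in
      l (alpha2 y) (l (alpha z) (r x v))
      - r (alpha2 x) (rho (alpha y) (rho z v))
      - l (alpha2 z) (r (mul y x) (beta v))
      - r (alpha (mul z x)) (rho (alpha y) (beta v))
      + r (mul (brk z y) (alpha x)) (beta2 v) = 0;
    bim_B4 : forall x y z v,
      let brk := bracket mul in
      let rho u w := l u w - r u w in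
      let alpha2 u := alpha (alpha u) in
      let beta2 w := beta (beta w) in
      r (mul (alpha y) (mul z x)) (beta2 v)
      + r (alpha2 x) (rho (brk y z) (beta v))
      - l (alpha2 y) (l (alpha z) (r x v))
      + r (alpha (mul y x)) (rho (alpha z) (beta v))
      + l (alpha2 z) (r (alpha x) (rho y v)) = 0;
    bim_B5 : forall x y z v,
      let brk := bracket mul in
      let alpha2 u := alpha (alpha u) in
      let beta2 w := beta (beta w) in
      l (brk (brk x y) (alpha z)) (beta2 v)
      - l (alpha2 x) (l (alpha y) (l z v))
      + l (alpha2 z) (l (alpha x) (l y v))
      + l (alpha (brk y z)) (l (alpha x) (beta v))
      + l (alpha2 y) (l (brk x z) (beta v)) = 0 }.

Record O_operator {A V} (mul : A -> A -> A) (alpha : A -> A)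
    (l r : A -> V -> V) (beta : V -> V) (T : V -> A) : Prop :=
  OOperator {
    oop_linear : linear T;
    oop_twist : {morph T : v / beta v >-> alpha v};
    oop_mul : forall a b, mul (T a) (T b) = T (l (T a) b + r (T b) a) }.

(* [tri] is the product with the black (or white) triangle pointing right,
   [tle] the one with the triangle pointing left. *)
Definition horizontal {A} (tri tle : A -> A -> A) (x y : A) : A :=
  tle x y + tri x y.

Definition diamond {A} (tri tle : A -> A -> A) (x y : A) : A :=
  tle x y - tri y x.

Record hom_M_dendriform {A} (tri tle : A -> A -> A) (alpha : A -> A) : Prop :=
  HomMDendriform {
    hmd_tri_bilinear : bilinear tri;
    hmd_tle_bilinear : bilinear tle;
    hmd_linear : linear alpha;
    hmd_tri_multiplicative : {morph alpha : x y / tri x y};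
    hmd_tle_multiplicative : {morph alpha : x y / tle x y};
    hmd_D1 : forall x y z t : A,
      let mul := horizontal tri tle in
      let dia := diamond tri tle in
      let brk := bracket mul in
      let alpha2 u := alpha (alpha u) in
      tri (dia (alpha z) (dia y x)) (alpha2 t)
      - tri (alpha2 x) (mul (alpha y) (mul z t))
      + tle (alpha2 z) (tri (alpha x) (mul y t))
      + tle (alpha (brk y z)) (alpha (tri x t))
      - tle (alpha2 y) (tri (dia z x) (alpha t)) = 0;
    hmd_D2 : forall x y z t : A,
      let mul := horizontal tri tle in
      let dia := diamond tri tle in
      let brk := bracket mul in
      let alpha2 u := alpha (alpha u) in
      tle (alpha2 z) (tle (alpha x) (tri y t))
      - tri (dia (alpha z) (dia x y)) (alpha2 t)
      - tle (alpha2 x) (tri (alpha y) (mul z t))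
      - tri (alpha (dia z y)) (alpha (mul x t))
      + tri (alpha2 y) (mul (brk x z) (alpha t)) = 0;
    hmd_D3 : forall x y z t : A,
      let mul := horizontal tri tle in
      let dia := diamond tri tle in
      let brk := bracket mul in
      let alpha2 u := alpha (alpha u) in
      tri (alpha2 z) (mul (alpha x) (mul y t))
      + tri (dia (brk x y) (alpha z)) (alpha2 t)
      - tle (alpha2 x) (tle (alpha y) (tri z t))
      + tri (alpha (dia y z)) (alpha (mul x t))
      + tle (alpha2 y) (tri (dia x z) (alpha t)) = 0;
    hmd_D4 : forall x y z t : A,
      let mul := horizontal tri tle in
      let brk := bracket mul in
      let alpha2 u := alpha (alpha u) in
      tle (brk (brk x y) (alpha z)) (alpha2 t)
      - tle (alpha2 x) (tle (alpha y) (tle z t))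
      + tle (alpha2 z) (tle (alpha x) (tle y t))
      + tle (alpha (brk y z)) (alpha (tle x t))
      + tle (alpha2 y) (tle (brk x z) (alpha t)) = 0 }.

Record hom_M_dendriform_morphism {A B}
    (triA tleA : A -> A -> A) (alphaA : A -> A)
    (triB tleB : B -> B -> B) (alphaB : B -> B) (f : A -> B) : Prop :=
  HomMDendriformMorphism {
    hmdm_linear : linear f;
    hmdm_tri : {morph f : x y / triA x y >-> triB x y};
    hmdm_tle : {morph f : x y / tleA x y >-> tleB x y};
    hmdm_twist : {morph f : x / alphaA x >-> alphaB x} }.

End Algebras.

(* The subspace T(V) of A as a vector space in its own right, with [\val] the
   inclusion into A and [corestrict T] the map T with codomain T(V). *)
Section Image.
Context {K : fieldType} {V A : lmodType K} (T : {linear V -> A}).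

Definition image_pred : {pred A} := [in range T].

Lemma image_submod_closed : submod_closed image_pred.
Proof.
split=> [|k _ _ /set_mem[v _ <-] /set_mem[w _ <-]]; apply/mem_set.
  by exists 0; rewrite ?linear0.
by exists (k *: v + w); rewrite ?linearP.
Qed.

HB.instance Definition _ :=
  GRing.isSubmodClosed.Build K A image_pred image_submod_closed.

Record image_space : predArgType :=
  ImageSpace { image_val : A; _ : image_val \in image_pred }.

HB.instance Definition _ := [isSub for image_val].
HB.instance Definition _ := [Choice of image_space by <:].
HB.instance Definition _ := [SubChoice_isSubLmodule of image_space by <:].

Lemma mem_image_pred v : T v \in image_pred.
Proof. by apply/mem_set; exists v. Qed.

Definition corestrict (v : V) : image_space := ImageSpace (mem_image_pred v).

End Image.

(* Main.v *)
(* The O-operator equation says T (horizontal a b) = T a * T b, and the diamond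
   product of V is a <> b = rho (T a) b.  Hence D1, D2, D3, D4 on V are the
   bimodule axioms B2, B3, B4, B5 evaluated at images of T, and adding D1-D4
   gives the Hom-pre-Malcev identity of the horizontal product.  On T(V) the
   products are well defined because T (r (T b) a) = T a * T b - T (l (T a) b)
   depends on a only through T a, and symmetrically T (l (T a) b) depends on b
   only through T b.  All identities then descend from V to T(V) along the
   surjection T. *)
Require Import Defs.
From mathcomp Require Import all_boot all_order all_algebra.
From mathcomp Require Import boolp classical_sets.

Set Implicit Arguments.
Unset Strict Implicit.
Unset Printing Implicit Defensive.

Import GRing.Theory.
Local Open Scope ring_scope.

Local Notation bilinear f := (bilinear_for *:%R *:%R f).

Section HomMDendriform.
Context {K : fieldType}.
Implicit Types A B V : lmodType K.

(** Linearity is a predicate on plain functions here, so its additive consequences are extracted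
    from the predicate itself. *)
Lemma linear_add A B (f : A -> B) : linear f -> {morph f : x y / x + y}.
Proof. by move=> lf x y; have := lf 1 x y; rewrite !scale1r. Qed.

Lemma linear_sub A B (f : A -> B) : linear f -> {morph f : x y / x - y}.
Proof. by move=> lf; apply: GRing.zmod_morphism_linear. Qed.

Lemma linear_zero A B (f : A -> B) : linear f -> f 0 = 0.
Proof. by move=> lf; rewrite -[X in f X](subrr 0) (linear_sub lf) subrr. Qed.

Lemma bilinear_horizontal A (tri tle : A -> A -> A) :
  bilinear tri -> bilinear tle -> bilinear (horizontal tri tle).
Proof.
move=> [tril trir] [tlel tler]; rewrite /horizontal; split=> z k x y /=.
  by rewrite tlel tril /= scalerDr addrACA.
by rewrite tler trir /= scalerDr addrACA.
Qed.

(** Serves to split a bracket in the left argument of [tri] into two diamonds, the form in which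
    D1-D3 contain it. *)
Lemma bracket_horizontal A (tri tle : A -> A -> A) x y :
  bracket (horizontal tri tle) x y = diamond tri tle x y - diamond tri tle y x.
Proof.
by rewrite /bracket /horizontal /diamond !opprD opprK
  [RHS](AC (2*2) ((1*4)*(3*2))).
Qed.

Lemma hom_pre_Malcev_horizontal A (tri tle : A -> A -> A) alpha :
  hom_M_dendriform tri tle alpha -> hom_pre_Malcev (horizontal tri tle) alpha.
Proof.
case=> btri btle lal mtri mtle D1 D2 D3 D4.
have tri_subl z x y : tri (x - y) z = tri x z - tri y z.
  exact: (linear_sub (btri.1 z)).
have tle_subr z x y : tle z (x - y) = tle z x - tle z y.
  exact: (linear_sub (btle.2 z)).
have tle_addr z x y : tle z (x + y) = tle z x + tle z y.
  exact: (linear_add (btle.2 z)).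
have al_sub : {morph alpha : x y / x - y} := linear_sub lal.
have al_add : {morph alpha : x y / x + y} := linear_add lal.
have al_mul :
    {morph alpha : u v / horizontal tri tle u v >-> horizontal tri tle u v}.
  by move=> u v; rewrite /horizontal al_add mtle mtri.
split=> //; first exact: bilinear_horizontal.
move=> x y z t /=.
have := D4 x y z t; have := D3 x y z t; have := D2 x y z t; have := D1 x y z t.
rewrite /=; set mul := horizontal tri tle in al_mul *.
set dia := diamond tri tle; set brk := bracket mul => E1 E2 E3 E4.
have mulE u v : mul u v = tle u v + tri u v by [].
have brkE u v : brk u v = dia u v - dia v u by exact: bracket_horizontal.
have dia_subr u v w : dia u (v - w) = dia u v - dia u w.
  by rewrite /dia /diamond tle_subr tri_subl !opprD opprK
    [RHS](AC (2*2) ((1*3)*(2*4))).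
have al_brk u v : brk (alpha u) (alpha v) = alpha (brk u v).
  by rewrite /brk /bracket al_sub !al_mul.
(* With the three operations opaque, [mulE] and [brkE] unfold only the selected occurrences. *)
clearbody brk dia mul.
(* Each of the five terms of the Hom-pre-Malcev identity is the sum of one term
   from each of D1, D2, D3, D4, listed in that order on the right-hand sides. *)
have G1 : mul (brk (alpha y) (alpha z)) (alpha (mul x t))
    = tle (alpha (brk y z)) (alpha (tri x t))
      - tri (alpha (dia z y)) (alpha (mul x t))
      + tri (alpha (dia y z)) (alpha (mul x t))
      + tle (alpha (brk y z)) (alpha (tle x t)).
  (* Under [tri] the bracket splits into diamonds, under [tle] the product [mul x t] splits into its
     summands; the other factors stay folded, as in D1-D4. *)
  rewrite al_brk mulE {2}brkE al_sub tri_subl.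
  by rewrite {1}mulE al_add tle_addr [RHS](ACl (4*1*(3*2))).
have G2 : mul (brk (brk x y) (alpha z)) (alpha (alpha t))
    = tri (dia (alpha z) (dia y x)) (alpha (alpha t))
      - tri (dia (alpha z) (dia x y)) (alpha (alpha t))
      + tri (dia (brk x y) (alpha z)) (alpha (alpha t))
      + tle (brk (brk x y) (alpha z)) (alpha (alpha t)).
  rewrite mulE {2}(brkE (brk x y)) tri_subl.
  rewrite [X in dia (alpha z) X]brkE dia_subr tri_subl opprB.
  by rewrite [RHS](ACl (4*(3*(1*2)))).
have G3 : mul (alpha (alpha y)) (mul (brk x z) (alpha t))
    = - tle (alpha (alpha y)) (tri (dia z x) (alpha t))
      + tri (alpha (alpha y)) (mul (brk x z) (alpha t))
      + tle (alpha (alpha y)) (tri (dia x z) (alpha t))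
      + tle (alpha (alpha y)) (tle (brk x z) (alpha t)).
  rewrite mulE {1}mulE {2}brkE tri_subl tle_addr tle_subr.
  by rewrite [RHS](ACl (4*(3*1)*2)).
have G4 : - mul (alpha (alpha x)) (mul (alpha y) (mul z t))
    = - tri (alpha (alpha x)) (mul (alpha y) (mul z t))
      - tle (alpha (alpha x)) (tri (alpha y) (mul z t))
      - tle (alpha (alpha x)) (tle (alpha y) (tri z t))
      - tle (alpha (alpha x)) (tle (alpha y) (tle z t)).
  rewrite mulE {1}(mulE (alpha y)) {1}mulE !tle_addr !opprD.
  by rewrite [RHS](ACl (4*3*2*1)).
have G5 : mul (alpha (alpha z)) (mul (alpha x) (mul y t))
    = tle (alpha (alpha z)) (tri (alpha x) (mul y t))
      + tle (alpha (alpha z)) (tle (alpha x) (tri y t))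
      + tri (alpha (alpha z)) (mul (alpha x) (mul y t))
      + tle (alpha (alpha z)) (tle (alpha x) (tle y t)).
  rewrite mulE {1}(mulE (alpha x)) {1}mulE !tle_addr.
  by rewrite [RHS](ACl (4*2*1*3)).
have add5ACA (a1 a2 a3 a4 a5 b1 b2 b3 b4 b5 : A) :
    (a1 + a2 + a3 + a4 + a5) + (b1 + b2 + b3 + b4 + b5)
    = (a1 + b1) + (a2 + b2) + (a3 + b3) + (a4 + b4) + (a5 + b5).
  by rewrite !(addrACA _ a5, addrACA _ a4, addrACA _ a3, addrACA _ a2).
(* The terms form an array with rows G1-G5 and columns D1-D4. Three uses of [add5ACA] regroup it by
   columns; each column, once reordered, vanishes by its identity. *)
rewrite G1 G2 G3 G4 G5 -add5ACA -[X in X + _]add5ACA.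
rewrite -[X in X + _ + _]add5ACA.
rewrite [X in X + _ + _ + _](ACl (2*4*5*1*3)) /= E1 add0r.
rewrite [X in X + _ + _](ACl (5*2*4*1*3)) /= E2 add0r.
rewrite [X in X + _](ACl (5*2*4*1*3)) /= E3 add0r.
by rewrite [LHS](ACl (2*4*5*1*3)).
Qed.

(** Every axiom, bilinearity included, is an equation between operations that [f] preserves; on
    chosen preimages it is the image under [f] of the same axiom in the source. *)
Lemma hom_M_dendriform_surj A B (triA tleA : A -> A -> A) alphaA
    (triB tleB : B -> B -> B) alphaB (f : A -> B) :
  hom_M_dendriform triA tleA alphaA ->
  hom_M_dendriform_morphism triA tleA alphaA triB tleB alphaB f ->
  (forall y, exists x, f x = y) ->
  hom_M_dendriform triB tleB alphaB.
Proof.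
move=> [[tril trir] [tlel tler] lal mtri mtle D1 D2 D3 D4] [lf ftri ftle fal].
move=> fsurj.
have f_add := linear_add lf; have f_sub := linear_sub lf.
have f0 := linear_zero lf.
have fmul :
    {morph f : u v / horizontal triA tleA u v >-> horizontal triB tleB u v}.
  by move=> u v; rewrite /horizontal f_add ftle ftri.
have fdia : {morph f : u v / diamond triA tleA u v >-> diamond triB tleB u v}.
  by move=> u v; rewrite /diamond f_sub ftle ftri.
have fbrk : {morph f : u v / bracket (horizontal triA tleA) u v
    >-> bracket (horizontal triB tleB) u v}.
  by move=> u v; rewrite /bracket f_sub !fmul.
pose fE := (f_sub, f_add, fbrk, fdia, fmul, ftri, ftle, fal).
split.
- by split=> z' k x' y'; have [x <-] := fsurj x'; have [y <-] := fsurj y';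
    have [z <-] := fsurj z'; rewrite /= -lf -!ftri -lf (tril, trir).
- by split=> z' k x' y'; have [x <-] := fsurj x'; have [y <-] := fsurj y';
    have [z <-] := fsurj z'; rewrite /= -lf -!ftle -lf (tlel, tler).
- by move=> k x' y'; have [x <-] := fsurj x'; have [y <-] := fsurj y';
    rewrite -!(lf, fal) lal.
- by move=> x' y'; have [x <-] := fsurj x'; have [y <-] := fsurj y';
    rewrite -!(ftri, fal) mtri.
- by move=> x' y'; have [x <-] := fsurj x'; have [y <-] := fsurj y';
    rewrite -!(ftle, fal) mtle.
all: move=> x' y' z' t' /=; have [x <-] := fsurj x'; have [y <-] := fsurj y';
  have [z <-] := fsurj z'; have [t <-] := fsurj t'.
- by have /(congr1 f) := D1 x y z t; rewrite /= f0 !fE.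
- by have /(congr1 f) := D2 x y z t; rewrite /= f0 !fE.
- by have /(congr1 f) := D3 x y z t; rewrite /= f0 !fE.
- by have /(congr1 f) := D4 x y z t; rewrite /= f0 !fE.
Qed.

(** In D1, D2, D3, D4 the vector acted on is [x], [y], [z], [t] respectively, and the other three
    variables act through [T]; this matches each identity with one bimodule axiom. *)
Lemma hom_M_dendriform_O_operator A V (mul : A -> A -> A) alpha
    (l r : A -> V -> V) beta (T : V -> A) :
  bimodule mul alpha l r beta -> O_operator mul alpha l r beta T ->
  hom_M_dendriform (fun a b => r (T b) a) (fun a b => l (T a) b) beta.
Proof.
move=> [[ll lr] [rl rr] lb B1l B1r B2 B3 B4 B5] [lT Tb Tmul].
set tri := fun a b => r (T b) a; set tle := fun a b => l (T a) b.
have Thor a b : T (horizontal tri tle a b) = mul (T a) (T b).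
  by rewrite Tmul.
have Tbrk a b : T (bracket (horizontal tri tle) a b) = bracket mul (T a) (T b).
  by rewrite /bracket (linear_sub lT) !Thor.
have bdia a b : beta (diamond tri tle a b) = diamond tri tle (beta a) (beta b).
  by rewrite /diamond (linear_sub lb) /tri /tle B1l B1r !Tb.
have triE a b : tri a b = r (T b) a by [].
have tleE a b : tle a b = l (T a) b by [].
have diaE a b : diamond tri tle a b = l (T a) b - r (T a) b by [].
split.
- by split=> z k x y; rewrite /tri /= ?lT (rl, rr).
- by split=> z k x y; rewrite /tle /= ?lT (ll, lr).
- exact: lb.
- by move=> x y; rewrite /tri B1r Tb.
- by move=> x y; rewrite /tle B1l Tb.
all: move=> x y z t /=.
(* [beta] moves inwards past diamonds and actions; then [T] turns products, brackets and twists of V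
   into those of A. *)
all: rewrite ?bdia !(triE, tleE) ?B1l ?B1r ?bdia ?diaE !(Tbrk, Thor, Tb).
- exact: B2.
- exact: B3.
- exact: B4.
- exact: B5.
Qed.

End HomMDendriform.

Theorem proposition4p3 (K : fieldType) (charK0 : [pchar K] =i pred0)
    (A V : lmodType K) (mul : A -> A -> A) (alpha : A -> A)
    (l r : A -> V -> V) (beta : V -> V) (T : {linear V -> A})
    (hA : hom_pre_Malcev mul alpha)
    (hV : bimodule mul alpha l r beta)
    (hT : O_operator mul alpha l r beta T) :
  let tri := fun a b : V => r (T b) a in
  let tle := fun a b : V => l (T a) b in
  [/\ hom_M_dendriform tri tle beta,
      hom_pre_Malcev (horizontal tri tle) beta,
      hom_pre_Malcev_morphism (horizontal tri tle) beta mul alpha T,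
      hom_pre_Malcev_subalgebra mul alpha (image_pred T) &
      exists (triT tleT : image_space T -> image_space T -> image_space T)
             (alphaT : image_space T -> image_space T),
        [/\ forall a b : V,
              triT (corestrict T a) (corestrict T b) = corestrict T (tri a b)
              /\ tleT (corestrict T a) (corestrict T b)
                 = corestrict T (tle a b),
            forall x, \val (alphaT x) = alpha (\val x),
            hom_M_dendriform triT tleT alphaT,
            hom_pre_Malcev (horizontal triT tleT) alphaT
            /\ (forall x y,
                  \val (horizontal triT tleT x y) = mul (\val x) (\val y)) &
            hom_M_dendriform_morphism tri tle beta triT tleT alphaT
              (corestrict T)]].
Proof.
move=> tri tle.
have Tb := oop_twist hT.
have Thor a b : T (horizontal tri tle a b) = mul (T a) (T b).
  by rewrite (oop_mul hT).
have Ttri a b : T (tri a b) = mul (T a) (T b) - T (l (T a) b).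
  by rewrite -Thor -linearB /horizontal addrC addKr.
have Ttle a b : T (tle a b) = mul (T a) (T b) - T (r (T b) a).
  by rewrite -Thor -linearB /horizontal addrK.
have dV : hom_M_dendriform tri tle beta.
  exact: hom_M_dendriform_O_operator hV hT.
have imP x : x \in image_pred T -> exists v, T v = x.
  by move=> /set_mem[v _ <-]; exists v.
have surj (x : image_space T) : exists v, corestrict T v = x.
  have [v Tv] := imP _ (valP x).
  by exists v; apply/val_inj.
(* A preimage of each point of T(V) is fixed by choice, and the operations on T(V) are computed on
   these preimages. *)
pose pre x := projT1 (cid (surj x)).
have preK x : corestrict T (pre x) = x by rewrite /pre; case: cid.
have Tpre v : T (pre (corestrict T v)) = T v := congr1 val (preK _).
pose triT x y := corestrict T (tri (pre x) (pre y)).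
pose tleT x y := corestrict T (tle (pre x) (pre y)).
pose alphaT x := corestrict T (beta (pre x)).
(* Independence of the chosen preimages: the right argument of [tri] and the left one of [tle] enter
   through [T] by definition, the remaining ones by [Ttri] and [Ttle] once [T] is applied. *)
have triTE : {morph corestrict T : a b / tri a b >-> triT a b}.
  by move=> a b; apply/val_inj; rewrite /= {2}/tri Tpre !Ttri Tpre.
have tleTE : {morph corestrict T : a b / tle a b >-> tleT a b}.
  by move=> a b; apply/val_inj; rewrite /= {2}/tle Tpre !Ttle Tpre.
have alphaTE : {morph corestrict T : a / beta a >-> alphaT a}.
  by move=> a; apply/val_inj; rewrite /= !Tb Tpre.
have mT :
    hom_M_dendriform_morphism tri tle beta triT tleT alphaT (corestrict T).
  by split=> // k u v; apply/val_inj; rewrite /= linearP.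
have dT : hom_M_dendriform triT tleT alphaT := hom_M_dendriform_surj dV mT surj.
split=> //; first exact: hom_pre_Malcev_horizontal.
- by split=> //; apply: (oop_linear hT).
- split; first exact: image_submod_closed.
    move=> _ _ /imP[a <-] /imP[b <-]; rewrite -Thor; exact: mem_image_pred.
  by move=> _ /imP[a <-]; rewrite -Tb; exact: mem_image_pred.
- exists triT, tleT, alphaT; split=> //.
  by move=> x; have [a <-] := surj x; rewrite -alphaTE /= Tb.
split; first exact: hom_pre_Malcev_horizontal.
move=> x y; have [a <-] := surj x; have [b <-] := surj y.
by rewrite /horizontal -triTE -tleTE -Thor /= -linearD.
Qed.
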